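(* Let $\Omega$ be a finite set with $n$ elements, $G(\Omega)$ the pair groupoid over $\Omega$, and $\tilde{\mathcal{S}}$ its canonical symmetroid. Let $\{V_p\}$ be a family of at most $n^2$ functions $V_p\in C_0(G(\Omega))$, and let $f_K\in C_0(\tilde{\mathcal{S}})$ be the function $$f_K((l,j),(k,m))=\sum_p V_p(l,j)\,V_p^{\ast}(k,m).$$ Then: (a) the linear map $K:C_0(G(\Omega))\cong M_n(\mathbb{C})\to M_n(\mathbb{C})$ determined by $f_K$ (via $t_1^*(K\tilde\psi)=f_K\star_S t_1^*\tilde\psi$) is completely positive; (b) $f_K$ is flat positive semidefinite: for every $M\in\mathbb{N}$, every complex vector $\{\xi_j\}_{j=1,\dots,M}$ and every $M$-tuple $\{\Gamma_j\}_{j=1,\dots,M}$ of elements of $\tilde{\mathcal{S}}$, $$\sum_{j,k=1}^{M}\overline{\xi}_k\,\xi_j\,f_K(\Gamma_j\circ_H\Gamma_k^{-H})\ \ge 0,$$ where the sum runs over the pairs $(j,k)$ for which $\Gamma_j\circ_H\Gamma_k^{-H}$ is defined; (c) $K$ is unital only if $\sum_p V_p\star V_p^{\ast}=\chi_\Omega$.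
   Context: Pair groupoid. $G(\Omega)=\Omega\times\Omega$, with counting measure; $(j,k)$ has target $j$ and source $k$, and $(j,k)\circ(k,l)=(j,l)$. $C_0(G(\Omega))$ is the space of complex functions on $G(\Omega)$ with convolution $(f\star g)(j,k)=\sum_{r\in\Omega}f(j,r)g(r,k)$ and involution $f^{\ast}(j,k)=\overline{f(k,j)}$; it is identified with $M_n(\mathbb{C})$ as a $*$-algebra. $\chi_\Omega$ is the characteristic function of the set of units $\{(j,j)\}$, i.e. the unit of this algebra. Canonical symmetroid of the pair groupoid. $\tilde{\mathcal{S}}$ is the set of all pairs $\Gamma=((l,j),(k,m))$ with $l,j,k,m\in\Omega$, regarded as a transformation from $s_1(\Gamma)=(j,k)$ to $t_1(\Gamma)=(l,m)$. The horizontal composition is $$((z,y),(x,w))\circ_H((z',y'),(x',w'))=((z,y),(x',w')),$$ defined exactly when $w=z'$ and $x=y'$. The horizontal inverse of $\Gamma=((z,y),(x,w))$ is $\Gamma^{-H}=((w,x),(y,z))$. Symmetroid algebra. $C_0(\tilde{\mathcal{S}})$ is the space of complex functions on $\tilde{\mathcal{S}}$ with the convolution $$(f\star_S g)((l,j),(k,m))=\sum_{r,s\in\Omega}f((l,r),(s,m))\,g((r,j),(k,s)).$$ For $\tilde\psi\in C_0(G(\Omega))$ let $t_1^*\tilde\psi=\tilde\psi\circ t_1\in C_0(\tilde{\mathcal{S}})$. For $f\in C_0(\tilde{\mathcal{S}})$ one has $(f\star_S t_1^*\tilde\psi)((l,j),(k,m))=\sum_{r,s}f((l,r),(s,m))\tilde\psi(r,s)$,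 which depends only on $(l,m)$, so $f$ determines a linear map on $C_0(G(\Omega))\cong M_n(\mathbb{C})$ sending $\tilde\psi$ to the function $(l,m)\mapsto\sum_{r,s}f((l,r),(s,m))\tilde\psi(r,s)$. A linear map $K$ on $M_n(\mathbb{C})$ is completely positive if $K\otimes\mathrm{id}$ on $M_n(\mathbb{C})\otimes M_M(\mathbb{C})$ maps positive semidefinite matrices to positive semidefinite matrices for every $M\in\mathbb{N}$, and unital if it maps the identity to the identity. *)

(* Defs.v *)
From mathcomp Require Import all_boot all_order all_algebra.
From mathcomp Require Import mxtens.

Set Implicit Arguments.
Unset Strict Implicit.
Unset Printing Implicit Defensive.

Import Order.TTheory GRing.Theory Num.Theory.
Local Open Scope ring_scope.
Local Open Scope sesquilinear_scope.

Section PairGroupoid.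
Variables (C : numClosedFieldType) (Omega : finType).

(* [(j, k)] has target [j] and source [k]. *)
Definition pair_groupoid : Type := (Omega * Omega)%type.

Definition C0G : Type := {ffun pair_groupoid -> C}.

Definition conv (f g : C0G) : C0G :=
  [ffun a => \sum_(r : Omega) f (a.1, r) * g (r, a.2)].

Definition invol (f : C0G) : C0G := [ffun a => (f (a.2, a.1))^*].

Definition chi : C0G := [ffun a => (a.1 == a.2)%:R].

(* The identification of functions with matrices, rows and columns being
   ordered by the enumeration of [Omega]. *)
Definition mx_of_fun (f : C0G) : 'M[C]_#|Omega| :=
  \matrix_(i, j) f (enum_val i, enum_val j).

Definition fun_of_mx (A : 'M[C]_#|Omega|) : C0G :=
  [ffun a => A (enum_rank a.1) (enum_rank a.2)].

Definition mx_map (K : C0G -> C0G) (A : 'M[C]_#|Omega|) : 'M[C]_#|Omega| :=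
  mx_of_fun (K (fun_of_mx A)).

Lemma mx_of_funK : cancel mx_of_fun fun_of_mx.
Proof. by move=> f; apply/ffunP=> -[x y]; rewrite !ffunE mxE !enum_rankK. Qed.

Lemma fun_of_mxK : cancel fun_of_mx mx_of_fun.
Proof. by move=> A; apply/matrixP=> i j; rewrite mxE ffunE !enum_valK. Qed.

Lemma mx_of_conv f g : mx_of_fun (conv f g) = mx_of_fun f *m mx_of_fun g.
Proof.
apply/matrixP=> i j; rewrite !mxE ffunE /=.
rewrite (reindex_onto enum_val enum_rank) => [|r _]; last exact: enum_rankK.
by apply: eq_big => [r|r _]; rewrite ?enum_valK ?eqxx // !mxE.
Qed.

Lemma mx_of_invol f : mx_of_fun (invol f) = (mx_of_fun f)^t*.
Proof. by apply/matrixP=> i j; rewrite !mxE ffunE. Qed.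

Lemma mx_of_chi : mx_of_fun chi = 1%:M.
Proof. by apply/matrixP=> i j; rewrite !mxE ffunE (inj_eq enum_val_inj). Qed.

End PairGroupoid.

Section Symmetroid.
Variables (C : numClosedFieldType) (Omega : finType).

(* [((l, j), (k, m))] is a transformation from [(j, k)] to [(l, m)]. *)
Definition symmetroid : Type :=
  ((Omega * Omega) * (Omega * Omega))%type.

Definition t1 (G : symmetroid) : pair_groupoid Omega := (G.1.1, G.2.2).

(* Horizontal composition is partial: [hcomp G G'] is meaningful only when
   [hcomposable G G']. *)
Definition hcomposable (G G' : symmetroid) : bool :=
  (G.2.2 == G'.1.1) && (G.2.1 == G'.1.2).

Definition hcomp (G G' : symmetroid) : symmetroid := (G.1, G'.2).

Definition hinv (G : symmetroid) : symmetroid :=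
  ((G.2.2, G.2.1), (G.1.2, G.1.1)).

Definition C0S : Type := {ffun symmetroid -> C}.

Definition convS (f g : C0S) : C0S :=
  [ffun G => let: ((l, j), (k, m)) := G in
     \sum_(r : Omega) \sum_(s : Omega) f ((l, r), (s, m)) * g ((r, j), (k, s))].

Definition t1_pull (psi : C0G C Omega) : C0S := [ffun G => psi (t1 G)].

Definition symm_map (f : C0S) (psi : C0G C Omega) : C0G C Omega :=
  [ffun a => \sum_(r : Omega) \sum_(s : Omega)
               f ((a.1, r), (s, a.2)) * psi (r, s)].

Lemma symm_mapP (f : C0S) (psi phi : C0G C Omega) :
  t1_pull phi = convS f (t1_pull psi) <-> phi = symm_map f psi.
Proof.
split=> [/ffunP e | ->].
  apply/ffunP=> -[l m]; have := e ((l, l), (m, m)); rewrite !ffunE /= => ->.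
  by apply: eq_bigr => r _; apply: eq_bigr => s _; rewrite ffunE.
apply/ffunP=> -[[l j] [k m]]; rewrite !ffunE /=.
by apply: eq_bigr => r _; apply: eq_bigr => s _; rewrite ffunE.
Qed.

Definition flat_psd (f : C0S) : Prop :=
  forall (M : nat) (xi : 'I_M -> C) (G : 'I_M -> symmetroid),
    0 <= \sum_(j < M) \sum_(k < M | hcomposable (G j) (hinv (G k)))
           (xi k)^* * xi j * f (hcomp (G j) (hinv (G k))).

End Symmetroid.

Section CompletePositivity.
Variable C : numClosedFieldType.

Definition psdmx (n : nat) (A : 'M[C]_n) : Prop :=
  A \is hermsymmx /\ forall v : 'cV[C]_n, 0 <= (v^t* *m A *m v) 0 0.

(* The entry [A (i, a) (j, b)] as [i], [j] vary, for [A] in the tensor product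
   of the [n x n] and the [M x M] matrices. *)
Definition tens_block (n M : nat) (A : 'M[C]_(n * M)) (a b : 'I_M) : 'M[C]_n :=
  \matrix_(i, j) A (mxtens_index (i, a)) (mxtens_index (j, b)).

(* [K] tensored with the identity of the [M x M] matrices. *)
Definition ampliation (n M : nat) (K : 'M[C]_n -> 'M[C]_n)
    (A : 'M[C]_(n * M)) : 'M[C]_(n * M) :=
  \sum_(a < M) \sum_(b < M) tensmx (K (tens_block A a b)) (delta_mx a b).

Definition completely_positive (n : nat) (K : 'M[C]_n -> 'M[C]_n) : Prop :=
  linear K /\
  forall (M : nat) (A : 'M[C]_(n * M)), psdmx A -> psdmx (ampliation K A).

Definition unital (n : nat) (K : 'M[C]_n -> 'M[C]_n) : Prop :=
  K 1%:M = 1%:M.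

Lemma ampliation_tens (n M : nat) (K : 'M[C]_n -> 'M[C]_n)
    (A : 'M[C]_n) (B : 'M[C]_M) :
  linear K -> ampliation K (tensmx A B) = tensmx (K A) B.
Proof.
move=> linK.
have K0 : K 0 = 0 by have := linK (-1) 0 0; rewrite scaleN1r oppr0 addr0 => ->;
  rewrite scaleN1r addNr.
have KZ c X : K (c *: X) = c *: K X by have := linK c X 0; rewrite K0 !addr0.
have blockE a b : tens_block (tensmx A B) a b = B a b *: A.
  by apply/matrixP=> i j; rewrite !mxE !mxtens_indexK mulrC.
apply/matrixP=> i j; case: (mxtens_indexP i) => i0 i1.
case: (mxtens_indexP j) => j0 j1; rewrite summxE tensmxE.
rewrite (bigD1 i1) //= [X in _ + X]big1 => [|a /negPf ne]; last first.
  by rewrite summxE big1 // => b _; rewrite tensmxE mxE eq_sym ne mulr0.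
rewrite addr0 summxE (bigD1 j1) //= [X in _ + X]big1 => [|b /negPf ne].
  by rewrite addr0 tensmxE blockE KZ !mxE !eqxx mulr1 mulrC.
by rewrite tensmxE mxE [j1 == b]eq_sym ne andbF mulr0.
Qed.

End CompletePositivity.

(* Main.v *)
(* In matrix form the map determined by [fK] is [A |-> \sum_p V_p A V_p^*], a
   Kraus decomposition: its ampliation is a sum of congruences by the matrices
   [V_p] tensored with the identity, and its value at [1] is the sum in (c).
   For (b), the composite of [G_j] with the horizontal inverse of [G_k] is
   defined exactly when [G_j] and [G_k] have the same second component [u], and
   [fK] then takes the value [\sum_p V_p (G_j.1) * (V_p (G_k.1))^*]; so the
   quadratic form is a sum of squared moduli indexed by [p] and [u]. *)
Require Import Defs.
From mathcomp Require Import all_boot all_order all_algebra.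
From mathcomp Require Import mxtens reals complex.

Set Implicit Arguments.
Unset Strict Implicit.
Unset Printing Implicit Defensive.

Import Order.TTheory GRing.Theory Num.Theory.
Local Open Scope ring_scope.
Local Open Scope complex_scope.
Local Open Scope sesquilinear_scope.

Section KrausMaps.
Variable C : numClosedFieldType.

Lemma adjmxM (m n p : nat) (A : 'M[C]_(m, n)) (B : 'M[C]_(n, p)) :
  (A *m B)^t* = B^t* *m A^t*.
Proof. by rewrite trmx_mul map_mxM. Qed.

Lemma psdmx0 (n : nat) : psdmx (0 : 'M[C]_n).
Proof.
split; last by move=> v; rewrite mulmx0 mul0mx mxE.
by apply/is_hermitianmxP; rewrite trmx0 map_mx0 scaler0.
Qed.

Lemma psdmxD (n : nat) (A B : 'M[C]_n) : psdmx A -> psdmx B -> psdmx (A + B).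
Proof.
move=> [/is_hermitianmxP hA pA] [/is_hermitianmxP hB pB]; split.
  by apply/is_hermitianmxP; rewrite linearD map_mxD scalerDr -hA -hB.
by move=> v; rewrite mulmxDr mulmxDl mxE addr_ge0.
Qed.

Lemma psdmx_sum (I : finType) (n : nat) (A : I -> 'M[C]_n) :
  (forall i, psdmx (A i)) -> psdmx (\sum_i A i).
Proof.
move=> psdA; elim/big_ind: _ => //; [exact: psdmx0 | exact: psdmxD].
Qed.

(** The quadratic form of the new matrix at [v] is that of [A] at [T^t* *m v]. *)
Lemma psdmx_congr (m n : nat) (T : 'M[C]_(m, n)) (A : 'M[C]_n) :
  psdmx A -> psdmx (T *m A *m T^t*).
Proof.
move=> [/is_hermitianmxP hA pA]; split.
  apply/is_hermitianmxP; rewrite {1}hA !expr0 !scale1r.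
  by rewrite !adjmxM trmxCK mulmxA.
by move=> v; have := pA (T^t* *m v); rewrite adjmxM trmxCK !mulmxA.
Qed.

(** Read from right to left, this expands [A] into its blocks tensored with matrix units, so that a
    congruence can be computed block by block. *)
Lemma ampliation_id (n M : nat) (A : 'M[C]_(n * M)) : ampliation id A = A.
Proof.
apply/matrixP=> i j; case: (mxtens_indexP i) => i0 i1.
case: (mxtens_indexP j) => j0 j1; rewrite summxE.
rewrite (bigD1 i1) //= [X in _ + X]big1 ?addr0 => [|a /negPf ne]; last first.
  by rewrite summxE big1 // => b _; rewrite tensmxE !mxE eq_sym ne mulr0.
rewrite summxE (bigD1 j1) //= [X in _ + X]big1 ?addr0 => [|b /negPf ne].
  by rewrite tensmxE !mxE !eqxx mulr1.
by rewrite tensmxE !mxE [j1 == b]eq_sym ne andbF mulr0.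
Qed.

Lemma ampliation_kraus (I : finType) (n M : nat) (W : I -> 'M[C]_n)
    (A : 'M[C]_(n * M)) :
  ampliation (fun X => \sum_p W p *m X *m (W p)^t*) A =
  \sum_p tensmx (W p) 1%:M *m A *m (tensmx (W p) 1%:M : 'M_(n * M))^t*.
Proof.
have tens_suml (F : I -> 'M[C]_n) (B : 'M[C]_M) :
    tensmx (\sum_p F p) B = \sum_p tensmx (F p) B.
  apply/matrixP=> i j; case: (mxtens_indexP i) => i0 i1.
  case: (mxtens_indexP j) => j0 j1; rewrite tensmxE !summxE mulr_suml.
  by apply: eq_bigr => p _; rewrite tensmxE.
(* After expanding [A] on the right, both sides are sums over [a], [b] and [p]. Termwise,
   conjugating a block tensor a matrix unit by [W p] tensor [1] acts on the block alone. *)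
under [RHS]eq_bigr => p _ do rewrite -{1}(ampliation_id A) mulmx_sumr mulmx_suml.
rewrite exchange_big; apply: eq_bigr => a _ /=.
under [RHS]eq_bigr => p _ do rewrite mulmx_sumr mulmx_suml.
rewrite exchange_big; apply: eq_bigr => b _ /=.
rewrite tens_suml; apply: eq_bigr => p _.
by rewrite trmx_tens map_mxT trmx1 map_mx1 !tensmx_mul mul1mx mulmx1.
Qed.

Lemma completely_positive_kraus (I : finType) (n : nat) (W : I -> 'M[C]_n)
    (K : 'M[C]_n -> 'M[C]_n) :
  (forall X, K X = \sum_p W p *m X *m (W p)^t*) -> completely_positive K.
Proof.
move=> KE; split=> [c X Y|M A psdA].
  rewrite !KE scaler_sumr -big_split; apply: eq_bigr => p _.
  by rewrite mulmxDr mulmxDl -scalemxAr -scalemxAl.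
have -> : ampliation K A =
    ampliation (fun X => \sum_p W p *m X *m (W p)^t*) A.
  by apply: eq_bigr => a _; apply: eq_bigr => b _; rewrite KE.
rewrite ampliation_kraus; apply: psdmx_sum => p; exact: psdmx_congr.
Qed.

End KrausMaps.

Section KrausFunctions.
Variables (C : numClosedFieldType) (Omega P : finType).
Variables (V : P -> C0G C Omega) (fK : C0S C Omega).
Hypothesis fKE : forall l j k m : Omega,
  fK ((l, j), (k, m)) = \sum_(p : P) V p (l, j) * invol (V p) (k, m).

Lemma mx_map_symm_kraus (A : 'M[C]_#|Omega|) :
  mx_map (symm_map fK) A =
  \sum_p mx_of_fun (V p) *m A *m (mx_of_fun (V p))^t*.
Proof.
(* Writing [A] as the matrix of a function turns the products into convolutions, whose sums run over
   [Omega] as in [symm_map]; only the order of summation then differs. *)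
under eq_bigr => p _ do
  rewrite -{1}(fun_of_mxK A) -mx_of_invol -!mx_of_conv.
apply/matrixP=> i j; rewrite summxE !mxE ffunE.
under [RHS]eq_bigr => p _ do rewrite !mxE ffunE.
rewrite exchange_big [RHS]exchange_big /=; apply: eq_bigr => s _.
under [RHS]eq_bigr => p _ do rewrite ffunE mulr_suml.
rewrite exchange_big /=; apply: eq_bigr => r _.
by rewrite fKE mulr_suml; apply: eq_bigr => p _; rewrite mulrAC.
Qed.

Lemma flat_psd_kraus : flat_psd fK.
Proof.
move=> M xi G.
pose c p u := \sum_(j < M | (G j).2 == u) xi j * V p (G j).1.
suff -> : \sum_(j < M) \sum_(k < M | hcomposable (G j) (hinv (G k)))
            (xi k)^* * xi j * fK (hcomp (G j) (hinv (G k))) =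
          \sum_p \sum_u c p u * (c p u)^*.
  by do 2![apply: sumr_ge0 => ? _]; exact: mul_conjC_ge0.
have sq p : \sum_u c p u * (c p u)^* =
    \sum_(j < M) \sum_(k < M | (G k).2 == (G j).2)
      (xi j * V p (G j).1) * (xi k * V p (G k).1)^*.
  (* Pairs with equal second components are sorted by the common value [u]; for each [u] they form a
     full square, so the double sum factors. *)
  rewrite [RHS](partition_big (fun j => (G j).2) predT) //=.
  apply: eq_bigr => u _; rewrite /c mulr_suml.
  by apply: eq_bigr => j /eqP->; rewrite rmorph_sum mulr_sumr.
under [RHS]eq_bigr => p _ do rewrite sq.
rewrite [RHS]exchange_big; apply: eq_bigr => j _ /=.
rewrite [RHS]exchange_big; apply: eq_big => [k|k _] /=.
  case: (G j) (G k) => [? [a b]] [? [a' b']].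
  by rewrite /hcomposable /= xpair_eqE andbC [a == _]eq_sym [b == _]eq_sym.
case: (G j) (G k) => [[l r] ?] [[m s] ?].
(* The swap made by [hinv] on the first component of [G k] is undone by the swap in [invol], leaving
   the conjugate of [V p (G k).1]. *)
rewrite /hcomp /= fKE mulr_sumr; apply: eq_bigr => p _.
by rewrite ffunE /= rmorphM [_^* * xi j]mulrC mulrACA.
Qed.

Lemma sum_conv_unital_kraus :
  unital (mx_map (symm_map fK)) ->
  \sum_p conv (V p) (invol (V p)) = chi C Omega.
Proof.
rewrite /unital mx_map_symm_kraus => unitalK.
(* Functions are compared through their matrices, where the identity may be replaced by the Kraus
   sum at [1]. *)
apply: (can_inj (@mx_of_funK C Omega)); rewrite mx_of_chi -unitalK.
under [RHS]eq_bigr => p _ do rewrite mulmx1 -mx_of_invol -mx_of_conv.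
apply/matrixP=> i j; rewrite summxE mxE sum_ffunE.
by apply: eq_bigr => p _; rewrite mxE.
Qed.

End KrausFunctions.

Theorem mainTheorem3 (R : realType) (Omega : finType) (n : nat)
    (card_Omega : #|Omega| = n)
    (P : finType) (card_P : (#|P| <= n ^ 2)%N)
    (V : P -> C0G R[i] Omega)
    (fK : C0S R[i] Omega)
    (fKE : forall l j k m : Omega,
       fK ((l, j), (k, m)) = \sum_(p : P) V p (l, j) * invol (V p) (k, m)) :
  let K := symm_map fK in
  [/\ (forall psi : C0G R[i] Omega, t1_pull (K psi) = convS fK (t1_pull psi))
        /\ completely_positive (mx_map K),
      flat_psd fK
    & unital (mx_map K) ->
        \sum_(p : P) conv (V p) (invol (V p)) = chi R[i] Omega].
Proof.
split; first 1 last.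
- exact: flat_psd_kraus fKE.
- exact: sum_conv_unital_kraus fKE.
split=> [psi|]; first exact/symm_mapP.
exact: completely_positive_kraus (mx_map_symm_kraus fKE).
Qed.
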